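(* Let $(\mathscr{P},\mathcal{A},\mathbb{P})$ be a probability space and let $\mathbf{u}\in L^2(\mathscr{P};\mathbb{R}^{n_0})$. Let $l\ge2$, let $n_0\ge n_1\ge n_2\ge\dots\ge n_l$ be positive integers, and let $\rho:\mathbb{R}\to\mathbb{R}$ be bilipschitz. Set $E_0^*:=\mathsf{Id}_{\mathbb{R}^{n_0}}$ and, iteratively for $k=0,1,\dots,l-1$: - define $\mathbf{b}_k^*:=\mathbb{E}[E_k^*(\mathbf{u})]\in\mathbb{R}^{n_k}$; - let $\mathbf{V}_{k+1}^*\in\mathbb{R}^{n_k\times n_{k+1}}$ be a matrix whose columns are $n_{k+1}$ orthonormal eigenvectors of the covariance matrix $\boldsymbol{\Sigma}[E_k^*(\mathbf{u})]$ associated with its $n_{k+1}$ largest eigenvalues (counted with multiplicity); - define $E_{k+1}^*:\mathbb{R}^{n_0}\to\mathbb{R}^{n_{k+1}}$ by $E_{k+1}^*(\mathbf{v}):=\rho\big((\mathbf{V}_{k+1}^* )^\top(E_k^*(\mathbf{v})-\mathbf{b}_k^* )\big)$. Then $$\inf_{\boldsymbol{\Psi}\in\mathsf{SAE}_\rho}\mathbb{E}\|\mathbf{u}-\mathscr{R}(\boldsymbol{\Psi},\mathbf{u})\|^2\le\inf_{\boldsymbol{\Psi}\in\mathsf{SBAE}_\rho}\mathbb{E}\|\mathbf{u}-\mathscr{R}(\boldsymbol{\Psi},\mathbf{u})\|^2\le\inf_{\boldsymbol{\Psi}\in\mathsf{SOAE}_\rho}\mathbb{E}\|\mathbf{u}-\mathscr{R}(\boldsymbol{\Psi},\mathbf{u})\|^2\le\sum_{k=0}^{l-1}\mathrm{Lip}(\rho^{-1})^{2k}\sum_{i=n_{k+1}+1}^{n_k}\lambda_i\big(\boldsymbol{\Sigma}[E_k^*(\mathbf{u})]\big),$$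 where $\mathsf{SAE}_\rho,\mathsf{SBAE}_\rho,\mathsf{SOAE}_\rho$ abbreviate $\mathsf{SAE}_\rho(n_0,\dots,n_l)$, $\mathsf{SBAE}_\rho(n_0,\dots,n_l)$, $\mathsf{SOAE}_\rho(n_0,\dots,n_l)$.
   Context: $\|\cdot\|$ is the Euclidean norm. $L^2(\mathscr{P};\mathbb{R}^{n})$ is the space of random vectors $\mathbf{u}:\mathscr{P}\to\mathbb{R}^n$ with $\mathbb{E}\|\mathbf{u}\|^2<\infty$; for such $\mathbf{u}$, $\boldsymbol{\Sigma}[\mathbf{u}]:=\mathbb{E}[(\mathbf{u}-\mathbb{E}[\mathbf{u}])(\mathbf{u}-\mathbb{E}[\mathbf{u}])^\top]$ is its covariance matrix. For a positive semidefinite matrix $\mathbf{M}$, $\lambda_i(\mathbf{M})$ is its $i$-th eigenvalue in decreasing order, counting multiplicities. A map $\rho:\mathbb{R}\to\mathbb{R}$ is bilipschitz if there are $\eta,L>0$ with $\eta|x-y|\le|\rho(x)-\rho(y)|\le L|x-y|$ for all $x,y\in\mathbb{R}$; such a map is a bijection of $\mathbb{R}$ with bilipschitz inverse $\rho^{-1}$. $\mathrm{Lip}(f)$ denotes the (smallest) Lipschitz constant of $f$. $\rho$ and $\rho^{-1}$ act componentwise on vectors. Symmetric autoencoders: $\mathsf{SAE}_\rho(n_0,\dots,n_l)$ is the set of all $\boldsymbol{\Psi}=\{(\mathbf{E}_j,\mathbf{D}_j,\mathbf{e}_j,\mathbf{d}_j,\rho)\}_{j=1}^{l}$ with $\mathbf{E}_j\in\mathbb{R}^{n_j\times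 n_{j-1}}$, $\mathbf{D}_j\in\mathbb{R}^{n_{j-1}\times n_j}$, $\mathbf{e}_j\in\mathbb{R}^{n_j}$, $\mathbf{d}_j\in\mathbb{R}^{n_{j-1}}$. Its encoding layers are $e_j(\mathbf{h})=\rho(\mathbf{E}_j\mathbf{h}+\mathbf{e}_j)$ and its decoding layers are $d_j(\mathbf{h})=\mathbf{D}_j\rho^{-1}(\mathbf{h})+\mathbf{d}_j$. The encoder is $\mathscr{E}(\boldsymbol{\Psi},\cdot)=e_l\circ\dots\circ e_1:\mathbb{R}^{n_0}\to\mathbb{R}^{n_l}$, the decoder is $\mathscr{D}(\boldsymbol{\Psi},\cdot)=d_1\circ\dots\circ d_l:\mathbb{R}^{n_l}\to\mathbb{R}^{n_0}$, and the reconstruction map is $\mathscr{R}(\boldsymbol{\Psi},\cdot)=\mathscr{D}(\boldsymbol{\Psi},\mathscr{E}(\boldsymbol{\Psi},\cdot))$. Biorthogonal class: $\mathsf{SBAE}_\rho(n_0,\dots,n_l)$ is the set of $\boldsymbol{\Psi}\in\mathsf{SAE}_\rho(n_0,\dots,n_l)$ with $\mathbf{E}_j\mathbf{D}_j=\mathbf{I}_{n_j}$ and $\mathbf{E}_j\mathbf{d}_j=-\mathbf{e}_j$ for all $j=1,\dots,l$. Orthogonal class: $\mathsf{SOAE}_\rho(n_0,\dots,n_l)$ is the set of $\boldsymbol{\Psi}\in\mathsf{SBAE}_\rho(n_0,\dots,n_l)$ with $\mathbf{E}_j=\mathbf{D}_j^\top$ for all $j$. *)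

(* Defs.v *)
From mathcomp Require Import all_boot all_order all_algebra all_fingroup.
From mathcomp Require Import all_classical all_reals all_analysis.

Set Implicit Arguments.
Unset Strict Implicit.
Unset Printing Implicit Defensive.

Import Order.TTheory GRing.Theory Num.Theory.
Import numFieldNormedType.Exports.

Local Open Scope classical_set_scope.
Local Open Scope ring_scope.

(* The library norm on matrices is the sup norm, hence this definition. *)
Definition enorm (R : realType) (n : nat) (v : 'cV[R]_n) : R :=
  Num.sqrt (\sum_(i < n) v i ord0 ^+ 2).

(* Measurability for the Borel sigma-algebra of R^n is stated coordinatewise. *)
Definition L2_random_vector d (T : measurableType d) (R : realType)
    (P : probability T R) (n : nat) (u : T -> 'cV[R]_n) : Prop :=
  (forall i, measurable_fun [set: T] (fun w => u w i ord0)) /\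
  ('E_P[fun w => (enorm (u w) ^+ 2)%R] < +oo)%E.

Definition mx_expectation d (T : measurableType d) (R : realType)
    (P : probability T R) (m n : nat) (X : T -> 'M[R]_(m, n)) : 'M[R]_(m, n) :=
  \matrix_(i, j) fine 'E_P[fun w => X w i j].

Definition cov_mx d (T : measurableType d) (R : realType)
    (P : probability T R) (n : nat) (u : T -> 'cV[R]_n) : 'M[R]_n :=
  mx_expectation P (fun w => (u w - mx_expectation P u)
                             *m (u w - mx_expectation P u)^T).

(* The decreasing list of the roots of the characteristic polynomial, repeated
   according to multiplicity. It exists, and is unique, for symmetric M; the
   default [::] is used only when char_poly M does not split over R. *)
Definition eigenvalues (R : realType) (n : nat) (M : 'M[R]_n) : seq R :=
  xget [::] [set s : seq R | sorted >=%R s /\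
                             char_poly M = \prod_(x <- s) ('X - x%:P)].

(* Indices start at 0: lambda M i is the (i+1)-st largest eigenvalue. *)
Definition lambda (R : realType) (n : nat) (M : 'M[R]_n) (i : nat) : R :=
  (eigenvalues M)`_i.

(* The permutation s leaves the order of the columns free. *)
Definition top_eigenvectors (R : realType) (n m : nat) (M : 'M[R]_n)
    (V : 'M[R]_(n, m)) : Prop :=
  V^T *m V = 1%:M /\
  exists s : 'S_m, forall j, M *m col j V = lambda M (s j) *: col j V.

Definition bilipschitz (R : realType) (rho : R -> R) : Prop :=
  exists eta L : R, [/\ 0 < eta, 0 < L &
    forall x y, eta * `|x - y| <= `|rho x - rho y| <= L * `|x - y|].

Definition Lip (R : realType) (f : R -> R) : R :=
  inf [set k : R | 0 <= k /\ k.-lipschitz f].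

(* A genuine two-sided inverse whenever rho is bijective. *)
Definition rinv (R : realType) (rho : R -> R) : R -> R :=
  'pinv_(fun=> 0) [set: R] rho.

(* Layer j : 'I_l is the (j+1)-st layer; n k is the width n_k, and the values
   of n beyond l play no role. *)
Record sae_param (R : realType) (n : nat -> nat) (l : nat) := SAEParam {
  enc_mx : forall j : 'I_l, 'M[R]_(n j.+1, n j);
  dec_mx : forall j : 'I_l, 'M[R]_(n j, n j.+1);
  enc_bias : forall j : 'I_l, 'cV[R]_(n j.+1);
  dec_bias : forall j : 'I_l, 'cV[R]_(n j) }.

Definition enc_layer (R : realType) (rho : R -> R) n l
    (Psi : sae_param R n l) (j : 'I_l) (h : 'cV[R]_(n j)) : 'cV[R]_(n j.+1) :=
  map_mx rho (enc_mx Psi j *m h + enc_bias Psi j).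

Definition dec_layer (R : realType) (rho : R -> R) n l
    (Psi : sae_param R n l) (j : 'I_l) (h : 'cV[R]_(n j.+1)) : 'cV[R]_(n j) :=
  dec_mx Psi j *m map_mx (rinv rho) h + dec_bias Psi j.

(* f_(l-1) \o ... \o f_0 *)
Fixpoint compose_up (R : realType) (n : nat -> nat) (l : nat) :
    (forall j : 'I_l, 'cV[R]_(n j) -> 'cV[R]_(n j.+1)) ->
    'cV[R]_(n 0%N) -> 'cV[R]_(n l) :=
  match l with
  | 0%N => fun _ v => v
  | l'.+1 => fun f v =>
      f ord_max (compose_up (fun j => f (widen_ord (leqnSn l') j)) v)
  end.

(* g_0 \o ... \o g_(l-1) *)
Fixpoint compose_down (R : realType) (n : nat -> nat) (l : nat) :
    (forall j : 'I_l, 'cV[R]_(n j.+1) -> 'cV[R]_(n j)) ->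
    'cV[R]_(n l) -> 'cV[R]_(n 0%N) :=
  match l with
  | 0%N => fun _ v => v
  | l'.+1 => fun g v =>
      compose_down (fun j => g (widen_ord (leqnSn l') j)) (g ord_max v)
  end.

Definition encoder (R : realType) (rho : R -> R) n l (Psi : sae_param R n l) :
    'cV[R]_(n 0%N) -> 'cV[R]_(n l) :=
  compose_up (enc_layer rho Psi).

Definition decoder (R : realType) (rho : R -> R) n l (Psi : sae_param R n l) :
    'cV[R]_(n l) -> 'cV[R]_(n 0%N) :=
  compose_down (dec_layer rho Psi).

Definition reconstruction (R : realType) (rho : R -> R) n l
    (Psi : sae_param R n l) (v : 'cV[R]_(n 0%N)) : 'cV[R]_(n 0%N) :=
  decoder rho Psi (encoder rho Psi v).

Definition SAE (R : realType) n l : set (sae_param R n l) := [set: _].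

Definition SBAE (R : realType) n l : set (sae_param R n l) :=
  [set Psi | forall j, enc_mx Psi j *m dec_mx Psi j = 1%:M /\
                       enc_mx Psi j *m dec_bias Psi j = - enc_bias Psi j].

Definition SOAE (R : realType) n l : set (sae_param R n l) :=
  [set Psi | SBAE Psi /\ forall j, enc_mx Psi j = (dec_mx Psi j)^T].

Definition reconstruction_error d (T : measurableType d) (R : realType)
    (P : probability T R) (rho : R -> R) n l (u : T -> 'cV[R]_(n 0%N))
    (Psi : sae_param R n l) : \bar R :=
  'E_P[fun w => (enorm (u w - reconstruction rho Psi (u w)) ^+ 2)%R]%E.

(* The map E_k^* built from the matrices V k = V_(k+1)^*; only V 0, ...,
   V (k - 1) are used. *)
Fixpoint pca_encoder d (T : measurableType d) (R : realType)
    (P : probability T R) (rho : R -> R) (n : nat -> nat)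
    (u : T -> 'cV[R]_(n 0%N)) (V : forall k : nat, 'M[R]_(n k, n k.+1))
    (k : nat) : 'cV[R]_(n 0%N) -> 'cV[R]_(n k) :=
  match k with
  | 0%N => fun v => v
  | k'.+1 => fun v =>
      let E := pca_encoder P rho u V k' in
      map_mx rho ((V k')^T *m (E v - mx_expectation P (E \o u)))
  end.

(* Main.v *)
(** The first two inequalities are inclusions of classes. For the third, the
    layerwise PCA autoencoder E_k = V_k^T, D_k = V_k, e_k = - V_k^T b_k, d_k = b_k
    is orthogonal and its encoder is E_l^*. By Pythagoras, decoding a code y of
    layer k+1 leaves at layer k the squared error
    |(1 - V V^T)(h - b)|^2 + |rho^-1(E_(k+1)^* ) - rho^-1(y)|^2 with h = E_k^*,
    and the second term is at most Lip(rho^-1)^2 times the squared error at layer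
    k+1. Iterating and taking expectations gives the weights Lip^(2k), and
    E|(1 - V V^T)(h - b)|^2 = tr((1 - V V^T) Cov h) is the sum of the eigenvalues
    of Cov h not selected by V. That these add up to the trace is the real
    spectral theorem, obtained by diagonalizing over R[i]. *)
Require Import Defs.
From mathcomp Require Import all_boot all_order all_algebra all_fingroup.
From mathcomp Require Import all_classical all_reals all_analysis.
From mathcomp Require Import complex ring lra measurable_realfun.

Set Implicit Arguments.
Unset Strict Implicit.
Unset Printing Implicit Defensive.

Import Order.TTheory GRing.Theory Num.Theory.
Import numFieldNormedType.Exports.

Local Open Scope classical_set_scope.
Local Open Scope ring_scope.

(** * Eigenvalues and traces of real symmetric matrices *)

Lemma char_poly_conj (F : fieldType) n (P A : 'M[F]_n) :
  P \in unitmx -> char_poly (invmx P *m A *m P) = char_poly A.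
Proof.
move=> Pu; pose Q := map_mx (@polyC F) P.
have QVQ : map_mx polyC (invmx P) *m Q = 1%:M.
  by rewrite -map_mxM mulVmx// map_mx1.
(* Over the polynomial ring the whole characteristic matrix is conjugated, so multiplicativity of
   [\det] applies. *)
have -> : char_poly (invmx P *m A *m P)
    = \det (map_mx polyC (invmx P) *m char_poly_mx A *m Q).
  rewrite mulmxBr mulmxBl -!map_mxM /char_poly /char_poly_mx.
  by rewrite mul_mx_scalar -scalemxAl QVQ scalemx1.
by rewrite !det_mulmx mulrC mulrA -det_mulmx mulmx1C ?QVQ// det1 mul1r.
Qed.

(** Over R[i] the matrix is hermitian, hence unitarily diagonalizable with real eigenvalues; the
    factorization descends because the embedding is injective on polynomials. *)
Lemma symmetric_char_poly_split (R : rcfType) n (M : 'M[R]_n) :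
  M^T = M -> exists s : seq R, char_poly M = \prod_(x <- s) ('X - x%:P).
Proof.
move=> Msym; pose f := real_complex R.
have Mreal : map_mx f M \is a mxOver Num.real.
  by apply/mxOverP => i j; rewrite mxE; apply/complex_realP; exists (M i j).
have Mherm : map_mx f M \is hermsymmx.
  apply: realsym_hermsym => //; apply/is_hermitianmxP.
  rewrite expr0 scale1r map_mx_id//.
  by apply/matrixP => i j; rewrite !mxE -{1}Msym mxE.
have /orthomx_spectralP := hermitian_normalmx Mherm.
have /mxOverP := hermitian_spectral_diag_real Mherm.
set D := spectral_diag _; set Q := spectralmx _ => Dreal eqM.
exists [seq complex.Re (D 0 i) | i <- enum 'I_n].
apply: (@map_poly_inj _ _ f).
rewrite map_char_poly eqM char_poly_conj ?spectral_unit//.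
rewrite char_poly_trig ?diag_mx_is_trig// rmorph_prod big_map big_enum/=.
apply: eq_bigr => i _; rewrite rmorphB/= map_polyX map_polyC/= mxE eqxx mulr1n.
by rewrite RRe_real.
Qed.

Lemma eigenvaluesP (R : realType) n (M : 'M[R]_n) : M^T = M ->
  char_poly M = \prod_(x <- eigenvalues M) ('X - x%:P).
Proof.
move=> /symmetric_char_poly_split[s Ms]; rewrite /eigenvalues.
(* The sorted list of roots lies in the set, which excludes the default of [xget]. *)
case: xgetP => [x _ []//|/(_ (sort >=%R s))[]]; split.
  by apply: sort_sorted => x y; exact: le_total.
by rewrite Ms; apply: perm_big; rewrite perm_sym perm_sort.
Qed.

Lemma size_eigenvalues (R : realType) n (M : 'M[R]_n) :
  M^T = M -> size (eigenvalues M) = n.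
Proof.
move=> Msym; have := size_char_poly M.
by rewrite (eigenvaluesP Msym) size_prod_XsubC => -[].
Qed.

(** Vieta: minus the trace and minus the sum of the roots are both the coefficient of degree n - 1.
    Size 0 is treated apart, since no such degree exists there. *)
Lemma mxtrace_sum_lambda (R : realType) n (M : 'M[R]_n) : M^T = M ->
  \tr M = \sum_(0 <= i < n) lambda M i.
Proof.
move=> Msym; have [n0|n_gt0] := posnP n.
  by move: M {Msym}; rewrite n0 => M; rewrite big_geq// /mxtrace big_ord0.
have := char_poly_trace M n_gt0.
rewrite {1}(eigenvaluesP Msym) -[in n.-1](size_eigenvalues Msym).
rewrite coefPn_prod_XsubC ?size_eigenvalues// -?lt0n// => /oppr_inj <-.
by rewrite (big_nth 0) size_eigenvalues.
Qed.

(* For M = Cov X the left-hand side is the mean squared norm of the residual of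
   X - E X after orthogonal projection onto the range of V. *)
Lemma mxtrace_proj_top_eigenvectors (R : realType) n m (M : 'M[R]_n)
    (V : 'M[R]_(n, m)) :
  (m <= n)%N -> M^T = M -> top_eigenvectors M V ->
  \tr ((1%:M - V *m V^T) *m M) = \sum_(m <= i < n) lambda M i.
Proof.
move=> le_mn Msym [VV [s Vs]].
(* In the basis given by [V], [M] compresses to a diagonal matrix carrying the m largest
   eigenvalues, permuted by [s]; subtracting its trace from [\tr M] leaves the tail. *)
have MV : V^T *m (M *m V) = \matrix_(i, j) ((i == j)%:R * lambda M (s j)).
  apply/matrixP => i j.
  have -> : (V^T *m (M *m V)) i j = (V^T *m col j (M *m V)) i 0.
    by rewrite !mxE; apply: eq_bigr => k _; rewrite !mxE.
  rewrite colE -mulmxA -colE Vs -scalemxAr mxE mulrC.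
  by rewrite colE mulmxA VV mul1mx !mxE eqxx andbT.
rewrite mulmxBl mul1mx raddfB/= -mulmxA mxtrace_mulC -mulmxA MV.
rewrite (mxtrace_sum_lambda Msym) (big_cat_nat _ (n := m))//= addrC -addrA.
rewrite (_ : \tr _ = \sum_(0 <= i < m) lambda M i) ?subrr ?addr0//.
rewrite big_mkord (reindex_inj (@perm_inj _ s)).
by apply: eq_bigr => i _; rewrite mxE eqxx mul1r.
Qed.

(** * Bilipschitz maps of the line and their inverses *)

Lemma bilipschitz_inj (R : realType) (rho : R -> R) :
  bilipschitz rho -> injective rho.
Proof.
move=> [eta [L [eta0 _ rhoP]]] x y xy.
have /andP[+ _] := rhoP x y.
by rewrite xy subrr normr0 pmulr_rle0// normr_le0 subr_eq0 => /eqP.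
Qed.

Lemma lipschitz_bound_continuous (R : realType) (f : R -> R) (k : R) :
  (forall x y, `|f x - f y| <= k * `|x - y|) -> continuous f.
Proof.
move=> fk x; apply/cvgrPdist_le => e e0.
(* No sign is assumed for [k], and a positive divisor is needed. *)
have k1 : 0 < `|k| + 1 by rewrite ltr_wpDl.
near=> y; rewrite (le_trans (fk x y))// (@le_trans _ _ ((`|k| + 1) * `|x - y|))//.
  by rewrite ler_wpM2r// (le_trans (ler_norm k))// lerDl.
rewrite mulrC -ler_pdivlMr//; near: y.
by apply: cvgr_dist_le; rewrite ?divr_gt0//; exact: cvg_id.
Unshelve. all: by end_near. Qed.

(** A continuous injection is strictly monotone, so [rho (- a)] and [rho a] lie on opposite sides of
    [rho 0]. For large [a] the lower bound puts [v] between them, and the intermediate value theorem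
    applies. *)
Lemma bilipschitz_surj (R : realType) (rho : R -> R) (v : R) :
  bilipschitz rho -> exists x, rho x = v.
Proof.
move=> rho_bilip; have rho_inj := bilipschitz_inj rho_bilip.
move: rho_bilip => [eta [L [eta0 _ rhoP]]].
have rho_cont : continuous rho.
  by apply: (@lipschitz_bound_continuous _ _ L) => x y; have /andP[] := rhoP x y.
(* Chosen so that [eta * a] is at least the distance from [v] to [rho 0]; the added 1 keeps [a]
   positive. *)
pose a := `|v - rho 0| / eta + 1.
have a0 : 0 < a by rewrite ltr_wpDl// divr_ge0// ltW.
have far x : `|x| = a -> `|v - rho 0| <= `|rho x - rho 0|.
  move=> xa; have /andP[+ _] := rhoP x 0; apply: le_trans.
  by rewrite subr0 xa mulrDr mulrCA divff ?gt_eqF// !mulr1 lerDl ltW.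
have farp := far a (gtr0_norm a0).
have farn := far (- a) (etrans (normrN a) (gtr0_norm a0)).
have aa : - a <= a by rewrite (@le_trans _ _ 0)// ?oppr_le0 ltW.
have [x _ <-] : exists2 x, x \in `[- a, a] & rho x = v; last by exists x.
apply: IVT => //; first exact: continuous_subspaceT.
have na0 : - a < 0 by rewrite oppr_lt0.
have aI : {subset predT <= `]-oo, +oo[ : interval R} by [].
have rho_cont' : {within [set` `]-oo, +oo[], continuous rho}.
  exact: continuous_subspaceT.
rewrite ge_min le_max.
(* The increasing case comes first, then the decreasing one. *)
have [mono|mono] := itv_continuous_inj_mono rho_cont' (in2W rho_inj).
- have /= h1 := mono _ _ (aI (- a) isT) (aI 0 isT) na0.
  have /= h2 := mono _ _ (aI 0 isT) (aI a isT) a0.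
  move: farp farn; rewrite (gtr0_norm (_ : 0 < rho a - _)) ?subr_gt0//.
  rewrite (ltr0_norm (_ : rho (- a) - _ < 0)) ?subr_lt0// opprB !ler_norml.
  move=> /andP[h3 h4] /andP[h5 h6].
  by apply/andP; split; apply/orP; [left|right]; lra.
- have /= h1 := mono _ _ (aI 0 isT) (aI (- a) isT) na0.
  have /= h2 := mono _ _ (aI a isT) (aI 0 isT) a0.
  move: farp farn; rewrite (ltr0_norm (_ : rho a - _ < 0)) ?subr_lt0//.
  rewrite (gtr0_norm (_ : 0 < rho (- a) - _)) ?subr_gt0// opprB !ler_norml.
  move=> /andP[h3 h4] /andP[h5 h6].
  by apply/andP; split; apply/orP; [right|left]; lra.
Qed.

Lemma rinvK (R : realType) (rho : R -> R) :
  bilipschitz rho -> cancel (rinv rho) rho.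
Proof.
move=> rho_bilip y; apply: pinvK; rewrite inE/=.
by have [x <-] := bilipschitz_surj y rho_bilip; exists x.
Qed.

Lemma rinvKV (R : realType) (rho : R -> R) :
  bilipschitz rho -> cancel rho (rinv rho).
Proof.
move=> rho_bilip x; apply: pinvKV; rewrite ?inE// => y z _ _.
exact: bilipschitz_inj.
Qed.

(** For distinct points the difference quotient is a lower bound of all admissible constants, hence
    of their infimum. The bound by [k] makes the set of constants nonempty, with [|k|] as a
    nonnegative member. *)
Lemma Lip_bound (R : realType) (f : R -> R) (k : R) :
  (forall x y, `|f x - f y| <= k * `|x - y|) ->
  forall x y, `|f x - f y| <= Lip f * `|x - y|.
Proof.
move=> fk x y; have [->|xy] := eqVneq x y; first by rewrite !subrr normr0 mulr0.
have d0 : 0 < `|x - y| by rewrite normr_gt0 subr_eq0.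
rewrite -ler_pdivrMr//; apply: lb_le_inf.
  exists `|k|; split => // -[u v] _ /=.
  by rewrite (le_trans (fk u v))// ler_wpM2r// ler_norm.
by move=> j [_ /(_ (x, y))]; rewrite /= ler_pdivrMr//; apply.
Qed.

(** The lower bilipschitz bound, read at preimages, gives the constant 1/eta, which [Lip_bound]
    sharpens. *)
Lemma rinv_lipschitz (R : realType) (rho : R -> R) : bilipschitz rho ->
  forall x y, `|rinv rho x - rinv rho y| <= Lip (rinv rho) * `|x - y|.
Proof.
move=> rho_bilip; have rhoV := rinvK rho_bilip.
move: rho_bilip => [eta [L [eta0 _ rhoP]]].
apply: (@Lip_bound _ _ eta^-1) => x y; rewrite mulrC ler_pdivlMr// mulrC.
by have /andP[+ _] := rhoP (rinv rho x) (rinv rho y); rewrite !rhoV.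
Qed.

(** * Square-integrable random vectors and expectations of traces *)

Section square_integrable.
Context d (T : measurableType d) (R : realType) (P : probability T R).

Lemma Lfun_measurable (p : \bar R) (f : T -> R) :
  f \in Lfun P p -> measurable_fun [set: T] f.
Proof. by rewrite inE => /andP[+ _]; rewrite inE. Qed.

Lemma Lfun2P (f : T -> R) : measurable_fun [set: T] f ->
  P.-integrable [set: T] (EFin \o (fun x => f x ^+ 2)) -> f \in Lfun P 2%:E.
Proof.
move=> mf /integrableP[_ fi]; rewrite inE; apply/andP; split; rewrite inE//=.
rewrite /finite_norm unlock /Lnorm poweR_lty//; apply: le_lt_trans fi.
rewrite le_eqVlt; apply/orP; left; apply/eqP; apply: eq_integral => x _ /=.
by rewrite normrX -powR_mulrn// normr_id.
Qed.

Lemma Lfun1_le (f g : T -> R) : measurable_fun [set: T] f ->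
  (forall x, `|f x| <= g x) -> g \in Lfun P 1 -> f \in Lfun P 1.
Proof.
move=> mf fg /Lfun1_integrable gi; apply/Lfun1_integrable.
apply: le_integrable gi => //; first exact/measurable_EFinP.
by move=> x _ /=; rewrite lee_fin (le_trans (fg x))// ler_norm.
Qed.

Lemma Lfun2_lipschitz (rho : R -> R) (k : R) (f : T -> R) :
  (forall x y, `|rho x - rho y| <= k * `|x - y|) ->
  f \in Lfun P 2%:E -> rho \o f \in Lfun P 2%:E.
Proof.
move=> rhok f2; have mf := Lfun_measurable f2.
have mrf : measurable_fun [set: T] (rho \o f).
  apply: measurableT_comp => //.
  apply: continuous_measurable_fun.
  exact: lipschitz_bound_continuous rhok.
apply: Lfun2P => //; apply/Lfun1_integrable.
(* An affine majorant of [|rho \o f|]; its constant term is square integrable because [P] is a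
   probability. *)
pose g := (cst `|rho 0| : T -> R) + (`|k| \o* (Num.norm \o f)).
have g2 : g \in Lfun P 2%:E.
  apply: rpredD => [|?|?]; [exact: lee1n|exact: Lfun_cst|].
  apply: Lfun_scale; first by rewrite ler1n.
  apply: Lfun2P; first exact: measurableT_comp.
  apply: eq_integrable (Lfun2_integrable_sqr f2) => // x _ /=.
  by rewrite real_normK// num_real.
have gE x : g x = `|rho 0| + `|f x| * `|k| by [].
apply: (Lfun1_le _ _ (Lfun2_mul_Lfun1 g2 g2)) => [|x /=].
  exact: measurable_funX.
rewrite normrX -expr2 lerXn2r ?nnegrE//.
  by rewrite gE addr_ge0 ?mulr_ge0.
rewrite gE -[rho (f x)](subrK (rho 0)) addrC.
rewrite (le_trans (ler_normD _ _))// lerD2l (le_trans (rhok _ _))// subr0 mulrC.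
by rewrite ler_wpM2l// ler_norm.
Qed.

Lemma Lfun_lincomb (r : R) (I : finType) (a : I -> R) (X : I -> T -> R) :
  1 <= r -> (forall i, X i \in Lfun P r%:E) ->
  (fun w => \sum_i a i * X i w) \in Lfun P r%:E.
Proof.
move=> r1 Xr; rewrite (_ : (fun _ => _) = \sum_i (a i \o* X i)).
  by apply: rpred_sum => i _; exact: Lfun_scale.
by apply/funext => w; rewrite fct_sumE; apply: eq_bigr => i _; rewrite /= mulrC.
Qed.

Lemma expectation_lincomb (I : finType) (a : I -> R) (X : I -> T -> R) :
  (forall i, X i \in Lfun P 1) ->
  ('E_P[fun w => (\sum_i a i * X i w)%R] = (\sum_i a i * fine 'E_P[X i])%R%:E)%E.
Proof.
move=> X1; rewrite unlock.
rewrite (eq_integral (fun w => \sum_i (a i * X i w)%:E)%E); last first.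
  by move=> w _; rewrite sumEFin.
rewrite integral_sum//=; last first.
  move=> i; apply/Lfun1_integrable; have := Lfun_scale (a i) (lexx 1) (X1 i).
  rewrite (_ : _ \o* _ = fun w => a i * X i w)//.
  by apply/funext => w /=; rewrite mulrC.
rewrite -sumEFin; apply: eq_bigr => i _.
rewrite EFinM fineK; last by have := expectation_fin_num (X1 i); rewrite unlock.
by rewrite -integralZl//; exact/Lfun1_integrable.
Qed.

(** One sum over index pairs makes the trace a linear combination of entries of [M], the form
    handled by [Lfun_lincomb] and [expectation_lincomb]. *)
Lemma mxtrace_mul_pair m n (W : 'M[R]_(m, n)) (M : 'M[R]_(n, m)) :
  \tr (W *m M) = \sum_(p : 'I_m * 'I_n) W p.1 p.2 * M p.2 p.1.
Proof.
rewrite -(pair_bigA _ (fun i j => W i j * M j i))/=.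
by apply: eq_bigr => i _; rewrite mxE.
Qed.

Lemma Lfun1_mxtrace m n (W : 'M[R]_(m, n)) (M : T -> 'M[R]_(n, m)) :
  (forall i j, (fun w => M w i j) \in Lfun P 1) ->
  (fun w => \tr (W *m M w)) \in Lfun P 1.
Proof.
move=> M1; under eq_fun do rewrite mxtrace_mul_pair.
exact: (@Lfun_lincomb 1 _ (fun p => W p.1 p.2) (fun p w => M w p.2 p.1)).
Qed.

Lemma expectation_mxtrace m n (W : 'M[R]_(m, n)) (M : T -> 'M[R]_(n, m)) :
  (forall i j, (fun w => M w i j) \in Lfun P 1) ->
  ('E_P[fun w => (\tr (W *m M w))%R] = (\tr (W *m mx_expectation P M))%R%:E)%E.
Proof.
move=> M1; under eq_fun do rewrite mxtrace_mul_pair.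
rewrite (@expectation_lincomb _ (fun p => W p.1 p.2) (fun p w => M w p.2 p.1))//.
by rewrite mxtrace_mul_pair; congr EFin; apply: eq_bigr => p _; rewrite mxE.
Qed.

(** The coordinatewise form of square integrability passes easily through affine maps and
    componentwise activations. *)
Definition Lvec2 n (X : T -> 'cV[R]_n) :=
  forall i, (fun w => X w i ord0) \in Lfun P 2%:E.

Lemma enorm_sqr n (v : 'cV[R]_n) : enorm v ^+ 2 = \sum_i v i ord0 ^+ 2.
Proof. by rewrite sqr_sqrtr// sumr_ge0// => i _; exact: sqr_ge0. Qed.

Lemma L2_random_vector_Lvec2 n (X : T -> 'cV[R]_n) :
  L2_random_vector P X -> Lvec2 X.
Proof.
move=> [mX Xoo] i; apply: Lfun2P => //; apply/Lfun1_integrable.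
apply: (@Lfun1_le _ (fun w => enorm (X w) ^+ 2)).
- exact: measurable_funX.
- move=> w; rewrite enorm_sqr ger0_norm ?sqr_ge0// (bigD1 i)//= lerDl.
  by rewrite sumr_ge0// => j _; exact: sqr_ge0.
apply/Lfun1_integrable/integrableP; split.
  apply/measurable_EFinP; under eq_fun do rewrite enorm_sqr.
  by apply: measurable_sum => j; exact: measurable_funX.
move: Xoo; rewrite unlock; congr (_ < _)%E; apply: eq_integral => w _ /=.
by rewrite ger0_norm// sqr_ge0.
Qed.

Lemma Lvec2_mul m n (A : 'M[R]_(m, n)) (X : T -> 'cV[R]_n) :
  Lvec2 X -> Lvec2 (fun w => A *m X w).
Proof.
move=> X2 i; under eq_fun do rewrite mxE.
apply: (@Lfun_lincomb 2 _ (fun j => A i j) (fun j w => X w j ord0)) => //.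
by rewrite ler1n.
Qed.

Lemma Lvec2_cst n (b : 'cV[R]_n) : Lvec2 (fun=> b).
Proof. by move=> i; exact: Lfun_cst. Qed.

Lemma Lvec2D n (X Y : T -> 'cV[R]_n) :
  Lvec2 X -> Lvec2 Y -> Lvec2 (fun w => X w + Y w).
Proof.
move=> X2 Y2 i; under eq_fun do rewrite mxE.
by apply: rpredD => [|?|?]; [exact: lee1n|exact: X2|exact: Y2].
Qed.

Lemma Lvec2B n (X Y : T -> 'cV[R]_n) :
  Lvec2 X -> Lvec2 Y -> Lvec2 (fun w => X w - Y w).
Proof.
move=> X2 Y2 i; under eq_fun do rewrite !mxE.
by apply: rpredB => [|?|?]; [exact: lee1n|exact: X2|exact: Y2].
Qed.

Lemma Lvec2_map (rho : R -> R) (k : R) n (X : T -> 'cV[R]_n) :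
  (forall x y, `|rho x - rho y| <= k * `|x - y|) ->
  Lvec2 X -> Lvec2 (fun w => map_mx rho (X w)).
Proof.
move=> rhok X2 i; under eq_fun do rewrite mxE.
exact: (Lfun2_lipschitz rhok (X2 i)).
Qed.

Lemma Lvec2_outer n (X Y : T -> 'cV[R]_n) : Lvec2 X -> Lvec2 Y ->
  forall i j, (fun w => (X w *m (Y w)^T) i j) \in Lfun P 1.
Proof.
move=> X2 Y2 i j; under eq_fun do rewrite mxE big_ord1 mxE.
exact: (Lfun2_mul_Lfun1 (X2 i) (Y2 j)).
Qed.

Lemma Lvec2_enorm n (X : T -> 'cV[R]_n) :
  Lvec2 X -> (fun w => enorm (X w) ^+ 2) \in Lfun P 1.
Proof.
move=> X2; rewrite (_ : (fun _ => _) = fun w => \tr (1%:M *m (X w *m (X w)^T))).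
  by apply: Lfun1_mxtrace; exact: Lvec2_outer.
apply/funext => w; rewrite mul1mx enorm_sqr; apply: eq_bigr => i _.
by rewrite mxE big_ord1 mxE expr2.
Qed.

Lemma cov_mx_sym n (X : T -> 'cV[R]_n) : (cov_mx P X)^T = cov_mx P X.
Proof.
apply/matrixP => i j; rewrite !mxE; congr fine.
apply: f_equal; apply/funext => w.
by rewrite !mxE; apply: eq_bigr => k _; rewrite !mxE mulrC.
Qed.

End square_integrable.

(* Pythagoras: (1 - V V^T) X is orthogonal to the range of V. *)
Lemma enorm_sqr_proj (R : realType) n m (V : 'M[R]_(n, m)) (X : 'cV[R]_n)
    (z : 'cV[R]_m) : V^T *m V = 1%:M ->
  enorm (X - V *m z) ^+ 2
  = \tr ((1%:M - V *m V^T) *m (X *m X^T)) + enorm (V^T *m X - z) ^+ 2.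
Proof.
move=> VV.
(* With norms written as traces, only cyclicity of the trace and [V^T V = 1] are needed before
   [ring]. *)
have enormE k (v : 'cV[R]_k) : enorm v ^+ 2 = \tr (v^T *m v).
  rewrite enorm_sqr /mxtrace big_ord1 mxE.
  by apply: eq_bigr => i _; rewrite mxE expr2.
rewrite !enormE !raddfB/= !trmx_mul trmxK !mulmxBl mul1mx !raddfB/=.
rewrite (mxtrace_mulC X) -[V *m V^T *m _]mulmxA (mxtrace_mulC V) !mulmxA.
rewrite -(mulmxA z^T V^T V) VV mulmx1.
rewrite -[V^T *m X *m X^T *m V]mulmxA (mxtrace_mulC (V^T *m X)) !mulmxA.
ring.
Qed.

Lemma enorm_sqr_lipschitz (R : realType) (f : R -> R) (k : R) n (x y : 'cV[R]_n) :
  (forall x y, `|f x - f y| <= k * `|x - y|) ->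
  enorm (map_mx f x - map_mx f y) ^+ 2 <= k ^+ 2 * enorm (x - y) ^+ 2.
Proof.
move=> fk; rewrite !enorm_sqr mulr_sumr; apply: ler_sum => i _; rewrite !mxE.
rewrite -exprMn -[leLHS]real_normK ?num_real// -[leRHS]real_normK ?num_real//.
rewrite lerXn2r ?nnegrE// (le_trans (fk _ _))// normrM.
by rewrite ler_wpM2r// ler_norm.
Qed.

(** * The layerwise principal component autoencoder *)

Section principal_autoencoder.
Context d (T : measurableType d) (R : realType) (P : probability T R).
Variables (n : nat -> nat) (rho : R -> R) (u : T -> 'cV[R]_(n 0%N)).
Variable V : forall k : nat, 'M[R]_(n k, n k.+1).

Local Notation E := (pca_encoder P rho u V).
Let b k := mx_expectation P (E k \o u).
(** The decoding layers of [pca_sae l], written without [l] so that induction on the depth is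
    possible. *)
Let g k (h : 'cV[R]_(n k.+1)) := V k *m map_mx (rinv rho) h + b k.
(** The squared norm lost by projection at layer k, when [V k] has orthonormal columns. The trace
    form is linear in the outer product, whose mean is the covariance. *)
Let c k w := \tr ((1%:M - V k *m (V k)^T) *m
  ((E k (u w) - b k) *m (E k (u w) - b k)^T)).

Definition pca_sae l : sae_param R n l :=
  SAEParam (fun j : 'I_l => (V j)^T) (fun j : 'I_l => V j)
    (fun j : 'I_l => - ((V j)^T *m b j)) (fun j : 'I_l => b j).

Lemma pca_sae_SOAE l :
  (forall k, (k < l)%N -> (V k)^T *m V k = 1%:M) -> SOAE (pca_sae l).
Proof.
by move=> VV; split=> j /=; rewrite ?trmxK// opprK; split=> //; exact: VV.
Qed.

Lemma encoder_pca_sae l : encoder rho (pca_sae l) =1 E l.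
Proof.
move=> v; rewrite /encoder.
by elim: l => //= l IHl; rewrite IHl /enc_layer/= mulmxBr.
Qed.

(* An arbitrary code y, instead of the encoding of u w, makes the induction on
   the outermost layer go through. *)
Lemma pca_sae_residual l w (y : 'cV[R]_(n l)) : bilipschitz rho ->
  (forall k, (k < l)%N -> (V k)^T *m V k = 1%:M) ->
  enorm (u w - compose_down (fun j : 'I_l => g (k := j)) y) ^+ 2 <=
  \sum_(k < l) Lip (rinv rho) ^+ (2 * k) * c k w +
    Lip (rinv rho) ^+ (2 * l) * enorm (E l (u w) - y) ^+ 2.
Proof.
move=> rho_bilip; elim: l y => [|l IHl] y VV /=.
  by rewrite big_ord0 add0r muln0 expr0 mul1r.
(* The outermost layer turns [y] into the code [g y] of the shallower autoencoder. *)
apply: le_trans (IHl (g y) _) _; first by move=> k kl; apply: VV; exact: ltnW.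
rewrite big_ord_recr/= -addrA lerD2l.
rewrite mulnS exprD [_ ^+ 2 * _]mulrC -mulrA -mulrDr ler_wpM2l//.
  by rewrite exprM exprn_ge0// sqr_ge0.
rewrite /g opprD addrA addrAC (enorm_sqr_proj _ _ (VV _ (leqnn _))) lerD2l.
(* The projected centred code is the preactivation of layer [l.+1], so [rinv rho] recovers it from
   the encoding. *)
have zE : (V l)^T *m (E l (u w) - b l) = map_mx (rinv rho) (E l.+1 (u w)).
  by apply/matrixP => i j; rewrite !mxE rinvKV.
rewrite [X in enorm (X - map_mx _ y)]zE.
exact: enorm_sqr_lipschitz (rinv_lipschitz rho_bilip).
Qed.

Hypothesis u2 : Lvec2 P u.
Hypothesis rho_bilip : bilipschitz rho.

Lemma Lvec2_pca_encoder k : Lvec2 P (E k \o u).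
Proof.
elim: k => [//|k IHk] /=.
have [eta [L [_ _ rhoP]]] := rho_bilip.
apply: (@Lvec2_map _ _ _ _ _ L) => [x y|]; first by have /andP[] := rhoP x y.
by apply/Lvec2_mul/Lvec2B => //; exact: Lvec2_cst.
Qed.

(** Supplies the measurability of the reconstruction error that monotonicity of the expectation
    requires. *)
Lemma Lvec2_compose_down l (X : T -> 'cV[R]_(n l)) : Lvec2 P X ->
  Lvec2 P (fun w => compose_down (fun j : 'I_l => g (k := j)) (X w)).
Proof.
elim: l X => [//|l IHl] X X2 /=; apply: IHl.
apply: Lvec2D; last exact: Lvec2_cst.
exact/Lvec2_mul/(Lvec2_map (rinv_lipschitz rho_bilip)).
Qed.

Lemma reconstruction_error_pca_sae l :
  (forall k, (k < l)%N -> (V k)^T *m V k = 1%:M) ->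
  (reconstruction_error P rho u (pca_sae l) <=
   (\sum_(k < l) Lip (rinv rho) ^+ (2 * k) *
      \tr ((1%:M - V k *m (V k)^T) *m cov_mx P (E k \o u)))%:E)%E.
Proof.
move=> VV; rewrite /reconstruction_error.
have centered2 k : Lvec2 P (fun w => E k (u w) - b k).
  exact: Lvec2B (@Lvec2_pca_encoder k) (@Lvec2_cst _ _ _ _ _ (b k)).
have outer1 k := Lvec2_outer (centered2 k) (centered2 k).
have residual1 k : c k \in Lfun P 1 by exact: Lfun1_mxtrace.
have err2 : Lvec2 P (fun w => u w - reconstruction rho (pca_sae l) (u w)).
  apply: Lvec2B => // i; rewrite /reconstruction.
  under eq_fun do rewrite encoder_pca_sae.
  exact: (Lvec2_compose_down (@Lvec2_pca_encoder l)).
have residual_le w : enorm (u w - reconstruction rho (pca_sae l) (u w)) ^+ 2 <=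
    \sum_(k < l) Lip (rinv rho) ^+ (2 * k) * c k w.
  (* Taking for [y] the exact encoding makes the last term of the bound vanish. *)
  have := pca_sae_residual w (E l (u w)) rho_bilip VV.
  have enorm0 : enorm (0 : 'cV[R]_(n l)) ^+ 2 = 0.
    by rewrite enorm_sqr big1// => i _; rewrite mxE expr0n.
  rewrite subrr enorm0 mulr0 addr0.
  by rewrite /reconstruction encoder_pca_sae.
apply: (@le_trans _ _
  'E_P[fun w => (\sum_(k < l) Lip (rinv rho) ^+ (2 * k) * c k w)%R]%E).
  apply: expectation_le.
  - exact: Lfun_measurable (Lvec2_enorm err2).
  - apply: (@Lfun_measurable _ _ _ P 1).
    exact: (@Lfun_lincomb _ _ _ _ 1 _ (fun k : 'I_l => Lip (rinv rho) ^+ (2 * k))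
      (fun k : 'I_l => c k)).
  - by move=> w; exact: sqr_ge0.
  - by move=> w; apply: le_trans (residual_le w); exact: sqr_ge0.
  - exact/aeW.
rewrite (@expectation_lincomb _ _ _ _ _
  (fun k : 'I_l => Lip (rinv rho) ^+ (2 * k)) (fun k : 'I_l => c k))//.
rewrite lee_fin le_eqVlt; apply/orP; left; apply/eqP; apply: eq_bigr => k _.
by rewrite expectation_mxtrace.
Qed.

End principal_autoencoder.

Theorem corollary4p1 (R : realType) (d : measure_display)
    (T : measurableType d) (P : probability T R)
    (l : nat) (n : nat -> nat) (rho : R -> R) (u : T -> 'cV[R]_(n 0%N))
    (V : forall k : nat, 'M[R]_(n k, n k.+1))
    (u_L2 : L2_random_vector P u)
    (l_ge2 : (2 <= l)%N)
    (n_noninc : forall k, (k < l)%N -> (n k.+1 <= n k)%N)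
    (n_gt0 : forall k, (k <= l)%N -> (0 < n k)%N)
    (rho_bilip : bilipschitz rho)
    (V_top : forall k, (k < l)%N ->
       top_eigenvectors (cov_mx P (pca_encoder P rho u V k \o u)) (V k)) :
  [/\ (ereal_inf [set reconstruction_error P rho u Psi | Psi in @SAE R n l]
       <= ereal_inf [set reconstruction_error P rho u Psi | Psi in @SBAE R n l])%E,
      (ereal_inf [set reconstruction_error P rho u Psi | Psi in @SBAE R n l]
       <= ereal_inf [set reconstruction_error P rho u Psi | Psi in @SOAE R n l])%E
    & (ereal_inf [set reconstruction_error P rho u Psi | Psi in @SOAE R n l]
       <= (\sum_(k < l) Lip (rinv rho) ^+ (2 * k) *
             \sum_(n k.+1 <= i < n k)
               lambda (cov_mx P (pca_encoder P rho u V k \o u)) i)%R%:E)%E].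
Proof.
have VV k : (k < l)%N -> (V k)^T *m V k = 1%:M by move=> /V_top[].
split.
- by apply: le_ereal_inf; apply: image_subset.
- by apply: le_ereal_inf; apply: image_subset => Psi [].
apply: (@le_trans _ _ (reconstruction_error P rho u (pca_sae P rho u V l))).
  by apply: ereal_inf_lbound; exists (pca_sae P rho u V l) => //; exact: pca_sae_SOAE.
have u2 := L2_random_vector_Lvec2 u_L2.
apply: le_trans (reconstruction_error_pca_sae u2 rho_bilip VV) _.
rewrite lee_fin; apply: ler_sum => k _.
(* Each trace left by the error bound is the tail of the spectrum discarded by [V k]. *)
by rewrite (mxtrace_proj_top_eigenvectors (n_noninc _ _) (cov_mx_sym _ _) (V_top _ _)).
Qed.
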